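(* For every $\epsilon > 0$ there exists $p_0(\epsilon)$ such that for every prime $p \equiv 1 \pmod{3}$ with $p > p_0(\epsilon)$, \[ \#\{\text{primes } q < p^{\frac{1}{2}+\epsilon} : q \text{ is a cubic residue modulo } p\} > p^{\frac{1}{30}\epsilon}. \]
   Context: An integer $a$ is a cubic residue modulo the prime $p$ if $a \equiv y^3 \pmod{p}$ for some integer $y$ with $p \nmid y$. *)

(* Defs.v *)
From Stdlib Require Import Reals.
From mathcomp Require Import all_boot.
Set Implicit Arguments. Unset Strict Implicit. Unset Printing Implicit Defensive.

Definition cubic_residue (a p : nat) : Prop :=
  exists y : nat, ~~ (p %| y) /\ a = y ^ 3 %[mod p].

Definition cubic_residueb (a p : nat) : bool :=
  [exists y : 'I_p, ~~ (p %| y) && (a == y ^ 3 %[mod p])].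

Lemma cubic_residueP (a p : nat) : 0 < p -> reflect (cubic_residue a p) (cubic_residueb a p).
Proof.
move=> p0; apply: (iffP existsP).
  by case=> y /andP[hy /eqP e]; exists y.
case=> y [hy e]; exists (Ordinal (ltn_pmod y p0)) => /=.
by rewrite /dvdn modn_mod -/(dvdn p y) hy /= e modnXm.
Qed.

Definition count_cubic_prime_residues (p : nat) (X : R) : nat :=
  count (fun q => [&& prime q, (if Rlt_dec (INR q) X then true else false) & cubic_residueb q p])
        (iota 0 (Z.to_nat (up X))).

(* Main.v *)
(** Let [J = a + b w] be the Jacobi sum of a cubic character [chi] modulo [p],
    so that [a^2 - a b + b^2 = p], and let [f(u)] be the [sqrt(-3)]-part of
    [J (u + w)^3].  If a prime [q <> 3, p] divides [f(u)], then [J (u + w)^3] is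
    congruent to its conjugate modulo [q].  In characteristic [q] the Gauss sum
    [g] satisfies [g^3 = p J], so [g (u + w)] and its conjugate have the same cube,
    and comparing their images under Frobenius forces [chi q = 1]: [q] is a cubic
    residue.

    Let [u] run over [N] terms of a progression, of size about [N], a small power
    of [p].  The values [f(u)] are below [p^(1/2+eps)], and since [f] has at most
    three roots modulo any [q^k], a set of [K] primes contributes to the product of
    these values at most about [K^(6 N)] when [N] is a larger power of [K].  As all
    but few values have size at least [N^2 / 4], [K] cannot be small. *)

Require Import Defs.
From Stdlib Require Import Reals Znat Lra.
From mathcomp Require Import all_boot.
From mathcomp Require Import all_order all_algebra all_field cyclic.
From mathcomp Require Import ring zify.
Set Implicit Arguments. Unset Strict Implicit. Unset Printing Implicit Defensive.
Import Order.TTheory GRing.Theory Num.Theory.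

(** * Gauss and Jacobi sums over a finite field, with values in an arbitrary field *)

Section GaussSums.
Local Open Scope ring_scope.
Variables (K : finFieldType) (F : fieldType).

Definition mulchar (chi : K -> F) : Prop :=
  [/\ chi 0 = 0, chi 1 = 1 & {morph chi : x y / x * y}].

Definition gauss (chi psi : K -> F) : F := \sum_x chi x * psi x.
Definition jacobi (chi1 chi2 : K -> F) : F := \sum_x chi1 x * chi2 (1 - x).

Lemma mulchar_mul (chi1 chi2 : K -> F) :
  mulchar chi1 -> mulchar chi2 -> mulchar (fun x => chi1 x * chi2 x).
Proof.
move=> [z1 o1 m1] [z2 o2 m2]; split; first by rewrite z1 mul0r.
- by rewrite o1 o2 mulr1.
- by move=> x y; rewrite m1 m2 mulrACA.
Qed.

Lemma sum_mulchar (chi : K -> F) t :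
  mulchar chi -> t != 0 -> chi t != 1 -> \sum_x chi x = 0.
Proof.
move=> [_ _ chiM] t0 t1.
have: chi t * \sum_x chi x = \sum_x chi x.
  rewrite mulr_sumr [RHS](reindex_inj (mulfI t0)) /=.
  by apply: eq_bigr => x _; rewrite chiM.
move/eqP; rewrite -subr_eq0 -{2}[\sum_x chi x]mul1r -mulrBl mulf_eq0 subr_eq0.
by rewrite (negPf t1) => /eqP.
Qed.

Variable psi : K -> F.
Hypothesis psiD : {morph psi : x y / x + y >-> x * y}.
Hypothesis psi0 : psi 0 = 1.
Variable t : K.
Hypothesis psi_t : psi t != 1.

Lemma sum_addchar y : y != 0 -> \sum_x psi (x * y) = 0.
Proof.
move=> y0.
rewrite (reindex_inj (mulIf (invr_neq0 y0))) /=.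
under eq_bigr => x _ do rewrite mulfVK //.
have: psi t * \sum_x psi x = \sum_x psi x.
  rewrite mulr_sumr [RHS](reindex_inj (addrI t)) /=.
  by apply: eq_bigr => x _; rewrite psiD.
move/eqP; rewrite -subr_eq0 -{2}[\sum_x psi x]mul1r -mulrBl mulf_eq0 subr_eq0.
by rewrite (negPf psi_t) => /eqP.
Qed.

Lemma addchar_exp x n : psi x ^+ n = psi (x *+ n).
Proof. by elim: n => [|n IH]; rewrite ?expr0 ?mulr0n ?psi0 // exprS mulrS psiD IH. Qed.

(** Collect the double sum by [s = x + y]. The terms with [s = 0] form a multiple of the full sum of
    [chi1 * chi2], which vanishes because this character is not 1 at [s0]; for [s != 0], rescaling
    [x] by [s] splits off the Jacobi sum. *)
Lemma gauss_mul (chi1 chi2 : K -> F) s0 :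
    mulchar chi1 -> mulchar chi2 -> s0 != 0 -> chi1 s0 * chi2 s0 != 1 ->
  gauss chi1 psi * gauss chi2 psi
    = jacobi chi1 chi2 * gauss (fun x => chi1 x * chi2 x) psi.
Proof.
move=> h1 h2 s00 s01.
have hm := mulchar_mul h1 h2.
have [z1 o1 m1] := h1; have [z2 o2 m2] := h2.
rewrite /gauss big_distrlr /=.
under eq_bigr => x _.
  rewrite (reindex_inj (addIr (- x))) /=.
  under eq_bigr => s _.
    have -> : chi1 x * psi x * (chi2 (s - x) * psi (s - x))
      = chi1 x * chi2 (s - x) * psi s.
      by rewrite mulrACA -psiD [x + _]addrC subrK.
    over.
  over.
rewrite exchange_big /= mulr_sumr; apply: eq_bigr => s _.
rewrite -mulr_suml mulrA; congr (_ * _).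
have [->|s_n0] := eqVneq s 0.
  rewrite z1 mul0r mulr0.
  transitivity (chi2 (-1) * \sum_x chi1 x * chi2 x).
    rewrite mulr_sumr; apply: eq_bigr => x _.
    by rewrite sub0r -(mulN1r x) m2 mulrCA.
  by have /= -> := sum_mulchar hm s00 s01; rewrite mulr0.
rewrite (reindex_inj (mulfI s_n0)) /= mulr_suml; apply: eq_bigr => x _.
by rewrite m1 -{2}[s]mulr1 -mulrBr m2 mulrACA mulrC.
Qed.

(** After [x] is replaced by [y * x], the sum over [y] involves only the additive character at
    [y * (x + 1)], and orthogonality singles out [x = -1]. *)
Lemma gauss_mul_conj (chi1 chi2 : K -> F) s0 :
    mulchar chi1 -> mulchar chi2 -> s0 != 0 -> chi1 s0 != 1 ->
    (forall x, x != 0 -> chi1 x * chi2 x = 1) ->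
  gauss chi1 psi * gauss chi2 psi = chi1 (-1) * #|K|%:R.
Proof.
move=> h1 h2 s00 s01 h12.
have [z1 o1 m1] := h1; have [z2 o2 m2] := h2.
rewrite /gauss mulrC big_distrlr /= (bigD1 0) //= [X in X + _]big1 ?add0r; last first.
  by move=> x _; rewrite z2 !mul0r.
transitivity (\sum_(y | y != 0) \sum_x chi1 x * psi (y * (x + 1))).
  apply: eq_bigr => y y0.
  rewrite (reindex_inj (mulfI y0)) /=; apply: eq_bigr => x _.
  rewrite mulrDr mulr1 psiD m1; transitivity (chi1 y * chi2 y * chi1 x * (psi (y * x) * psi y)).
    by ring.
  by rewrite h12 // mul1r.
rewrite exchange_big /=.
transitivity (\sum_x chi1 x * ((x == -1)%:R * #|K|%:R - 1)).
  apply: eq_bigr => x _; rewrite -mulr_sumr; congr (_ * _).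
  have -> : \sum_(y | y != 0) psi (y * (x + 1)) = \sum_y psi (y * (x + 1)) - 1.
    by rewrite [in RHS](bigD1 0) //= mul0r psi0 [RHS]addrAC subrr add0r.
  congr (_ - 1); rewrite -addr_eq0; have [->|x1] := eqVneq (x + 1) 0.
    rewrite mul1r; under eq_bigr => y _ do rewrite mulr0 psi0.
    by rewrite sumr_const.
  by rewrite mul0r sum_addchar.
under eq_bigr => x _ do rewrite mulrBr mulr1.
rewrite sumrB (sum_mulchar h1 s00 s01) subr0 (bigD1 (-1)) //= eqxx mul1r.
by rewrite big1 ?addr0 // => x /negPf ->; rewrite mul0r mulr0.
Qed.

(** In characteristic [q] the [q]-th power is additive and turns [psi x] into [psi (x *+ q)];
    rescaling [x] by [q] then costs the factor [chi2 q]. *)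
Lemma gauss_frobenius (chi1 chi2 : K -> F) q :
    q \in [pchar F] -> q%:R != 0 :> K -> mulchar chi2 ->
    (forall x, chi1 x ^+ q = chi2 x) ->
  chi2 q%:R * gauss chi1 psi ^+ q = gauss chi2 psi.
Proof.
move=> qF q0 [_ _ m2] h12; rewrite /gauss -(pFrobenius_autE qF) rmorph_sum /=.
rewrite mulr_sumr [RHS](reindex_inj (mulIf q0)) /=; apply: eq_bigr => x _.
by rewrite pFrobenius_autE exprMn h12 addchar_exp m2 mulr_natr mulrA (mulrC (chi2 x)).
Qed.

End GaussSums.

(** * The cubic form attached to the Jacobi sum, and its prime divisors *)

Section CubicForm.
Local Open Scope ring_scope.

Lemma finField_prim_root (F : finFieldType) n :
  (0 < n)%N -> (n %| #|F|.-1)%N -> exists z : F, n.-primitive_root z.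
Proof.
move=> n0 ndvd.
have F1 : (0 < #|F|.-1)%N by rewrite -ltnS prednK ?finNzRing_gt1 // (ltn_trans _ (finNzRing_gt1 F)).
have /hasP[z _ zP] : has #|F|.-1.-primitive_root (enum (predC1 (0 : F))).
  apply: has_prim_root; rewrite ?enum_uniq -?cardE ?cardC1 //.
  apply/allP=> x; rewrite mem_enum inE /= => x0.
  rewrite unity_rootE; apply/eqP/(mulfI x0).
  by rewrite mulr1 -exprS prednK ?expf_card // (ltn_trans _ (finNzRing_gt1 F)).
by exists (z ^+ (#|F|.-1 %/ n)); apply: dvdn_prim_root.
Qed.

(** The field with [q ^ totient n] elements works: by Euler, [n] divides the order of its cyclic
    multiplicative group. *)
Lemma pchar_prim_root q n : prime q -> coprime q n -> (0 < n)%N ->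
  exists (F : finFieldType) (z : F), q \in [pchar F] /\ n.-primitive_root z.
Proof.
move=> qP cqn n0.
have [F qF cF] := @pPrimePowerField q (totient n) qP ltac:(by rewrite totient_gt0).
have [|z zP] := @finField_prim_root F n n0; last by exists F, z.
rewrite cF -subn1 -eqn_mod_dvd ?expn_gt0 ?prime_gt0 //.
by apply/eqP; apply: Euler_exp_totient.
Qed.

(* For a primitive cube root of unity [w], [(w - w^2) * cubf a b u] is
   [(a + b w) (u + w)^3] minus its conjugate. *)
Definition cubf (a b u : int) : int :=
  b * (u ^+ 3 - 3 * u ^+ 2 + 1) + 3 * a * (u ^+ 2 - u).

Lemma cubf_intr (F : fieldType) (a b u : int) : (cubf a b u)%:~R =
  b%:~R * (u%:~R ^+ 3 - 3 * u%:~R ^+ 2 + 1)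
    + 3 * a%:~R * (u%:~R ^+ 2 - u%:~R) :> F.
Proof. by rewrite /cubf; ring. Qed.

(** [ind] is a discrete logarithm to a primitive root. It is defined modulo [p - 1], hence modulo 3.
    Keeping an index instead of a character lets the same data give cubic characters both in [algC]
    and in characteristic [q]. *)
Lemma cubic_index (p : nat) : prime p -> p = 1 %[mod 3] ->
  exists ind : 'F_p -> nat,
    [/\ forall x y, x != 0 -> y != 0 -> ind (x * y) = (ind x + ind y)%N %[mod 3],
        exists2 g, g != 0 & ind g = 1%N %[mod 3]
      & forall x, x != 0 -> ind x = 0%N %[mod 3] -> exists2 y, y != 0 & x = y ^+ 3].
Proof.
move=> pP p3; have p1 := prime_gt1 pP.
have d3 : (3 %| p.-1)%N by rewrite -subn1 -eqn_mod_dvd ?prime_gt0 //; apply/eqP.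
have [|w wP] := @finField_prim_root 'F_p p.-1 ltac:(lia); first by rewrite card_Fp.
have w0 : w != 0.
  apply: contra_eqN (prim_expr_order wP) => /eqP ->.
  by rewrite expr0n gtn_eqF ?(prim_order_gt0 wP) // eq_sym oner_eq0.
have wE (x : 'F_p) : x != 0 -> exists i : 'I_(p.-1), x == w ^+ i.
  move=> x0; have [|i ->] := prim_rootP wP (x := x); last by exists i.
  have xp : x ^+ p = x by rewrite -[RHS](expf_card x) card_Fp.
  by apply: (mulfI x0); rewrite mulr1 -exprS prednK ?(ltnW p1).
pose ind (x : 'F_p) : nat := oapp (@nat_of_ord _) 0%N [pick i : 'I_(p.-1) | x == w ^+ i].
have indE x : x != 0 -> x = w ^+ ind x.
  move=> x0; rewrite /ind; case: pickP => [i /eqP //|no].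
  by have [i] := wE x x0; rewrite no.
have indM i x : x != 0 -> x = w ^+ i -> ind x = i %[mod 3].
  move=> x0 xi; have : w ^+ ind x == w ^+ i by rewrite -indE // -xi.
  rewrite (eq_prim_root_expr wP) => /eqP e.
  by rewrite -(modn_dvdm _ d3) e modn_dvdm.
exists ind; split.
- move=> x y x0 y0; apply: indM; first by rewrite mulf_neq0.
  by rewrite exprD -!indE.
- by exists w => //; apply: indM; rewrite ?expr1.
- move=> x x0 i0; exists (w ^+ (ind x %/ 3)); first by rewrite expf_neq0.
  by rewrite -exprM {1}(indE x x0) {1}(divn_eq (ind x) 3) i0 mod0n addn0.
Qed.

(** * Cubic characters and their Gauss sums *)

Section CubicCharacter.
Variables (p : nat) (ind : 'F_p -> nat).
Hypothesis pP : prime p.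
Hypothesis indM :
  forall x y, x != 0 -> y != 0 -> ind (x * y) = (ind x + ind y)%N %[mod 3].
Variable g : 'F_p.
Hypotheses (g0 : g != 0) (ind_g : ind g = 1%N %[mod 3]).

Definition chi (F : fieldType) (w : F) (x : 'F_p) : F :=
  if x == 0 then 0 else w ^+ ind x.

(* Counting expresses the Jacobi sum as [jacobi_a + jacobi_b * w] with integers
   that do not depend on the field in which the characters take their values. *)
Definition jacobi_ind (x : 'F_p) : nat := ind x + ind (1 - x).
Definition jacobi_count (k : nat) : nat :=
  #|[set x : 'F_p | [&& x != 0, 1 - x != 0 & (jacobi_ind x %% 3 == k)%N]]|.
Definition jacobi_a : int := (jacobi_count 0)%:Z - (jacobi_count 2)%:Z.
Definition jacobi_b : int := (jacobi_count 1)%:Z - (jacobi_count 2)%:Z.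

Section Field.
Variables (F : fieldType) (z : F).
Hypothesis zP : p.-primitive_root z.

Definition psi (x : 'F_p) : F := z ^+ (x : nat).

Lemma psiD : {morph psi : x y / x + y >-> x * y}.
Proof.
move=> x y; rewrite /psi -exprD -[RHS](prim_expr_mod zP) /=.
by congr (_ ^+ (_ %% _)%N); rewrite Fp_cast.
Qed.

Lemma psi0 : psi 0 = 1.
Proof. by rewrite /psi expr0. Qed.

Lemma psi1 : psi 1 != 1.
Proof.
by rewrite /psi -(expr0 z) (eq_prim_root_expr zP) /= !modn_small
  ?Fp_cast ?prime_gt0 ?prime_gt1.
Qed.

Lemma cube_root_sum (w : F) : 3.-primitive_root w -> 1 + w + w ^+ 2 = 0.
Proof.
move=> wP; have w1 : w - 1 != 0.
  by rewrite subr_eq0 -[w]expr1 -(expr0 w) (eq_prim_root_expr wP).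
by apply: (mulfI w1); rewrite mulr0 -[RHS](subrr 1) -{3}(prim_expr_order wP); ring.
Qed.

Lemma chi_mod (w : F) x : 3.-primitive_root w -> x != 0 ->
  chi w x = w ^+ (ind x %% 3)%N.
Proof. by move=> wP /negPf x0; rewrite /chi x0 (prim_expr_mod wP). Qed.

Lemma chi_mulchar (w : F) : w ^+ 3 = 1 -> mulchar (chi w).
Proof.
move=> w3.
have wm n : w ^+ (n %% 3)%N = w ^+ n by rewrite expr_mod.
split; first by rewrite /chi eqxx.
- have : ind 1 = 0%N %[mod 3].
    by apply/eqP; rewrite -(eqn_modDl (ind 1)) addn0 -indM ?oner_neq0 // mulr1.
  by rewrite /chi oner_eq0 => i1; rewrite -wm i1.
- move=> x y; rewrite /chi mulf_eq0.
  have [->|x0] := eqVneq x 0; first by rewrite /= mul0r.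
  have [->|y0] /= := eqVneq y 0; first by rewrite /= mulr0.
  by rewrite -exprD -wm indM // wm.
Qed.

Variable w : F.
Hypothesis wP : 3.-primitive_root w.

Let w3 : w ^+ 3 = 1 := prim_expr_order wP.
Let w2E : w ^+ 2 = - 1 - w.
Proof. by apply/eqP; rewrite -subr_eq0 -(cube_root_sum wP); apply/eqP; ring. Qed.

Let w23 : (w ^+ 2) ^+ 3 = 1. Proof. by rewrite exprAC w3 expr1n. Qed.

Lemma chi_sqr x : chi w x ^+ 2 = chi (w ^+ 2) x.
Proof. by rewrite /chi; case: eqP => _; rewrite ?expr0n // exprAC. Qed.

Lemma chi_conj x : x != 0 -> chi w x * chi (w ^+ 2) x = 1.
Proof. by move=> x0; rewrite -chi_sqr -exprS /chi (negPf x0) exprAC w3 expr1n. Qed.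

Lemma chi_cube x : x != 0 -> chi w x ^+ 3 = 1.
Proof. by move=> x0; rewrite exprS chi_sqr chi_conj. Qed.

Lemma chi_g_neq1 : chi w g != 1.
Proof.
by rewrite chi_mod // ind_g -(expr0 w) (eq_prim_root_expr wP).
Qed.

Lemma chi_m1 : chi w (-1) = 1.
Proof.
have [_ c1 cM] := chi_mulchar w3.
have m10 : (-1 : 'F_p) != 0 by rewrite oppr_eq0 oner_eq0.
have c2 : chi w (-1) ^+ 2 = 1 by rewrite expr2 -cM mulrNN mulr1.
by have := chi_cube m10; rewrite exprS c2 mulr1.
Qed.

Lemma jacobi_chi : jacobi (chi w) (chi w) = jacobi_a%:~R + jacobi_b%:~R * w.
Proof.
rewrite /jacobi.
transitivity (\sum_(x : 'F_p | (x != 0) && (1 - x != 0))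
    \sum_(k < 3) (jacobi_ind x %% 3 == k)%N%:R * w ^+ k).
  rewrite [RHS]big_mkcond; apply: eq_bigr => x _.
  rewrite /chi; case: eqP => _ /=; first by rewrite /= mul0r.
  case: eqP => _ /=; first by rewrite /= mulr0.
  rewrite (bigD1 (Ordinal (ltn_pmod (jacobi_ind x) (isT : 0 < 3)%N))) //=.
  rewrite eqxx mul1r expr_mod // exprD big1 ?addr0 // => k /negPf kn.
  by rewrite eq_sym -(inj_eq val_inj) /= in kn; rewrite kn mul0r.
have cE k : \sum_(x : 'F_p | (x != 0) && (1 - x != 0))
    (jacobi_ind x %% 3 == k)%N%:R * w ^+ k = (jacobi_count k)%:R * w ^+ k.
  rewrite -mulr_suml; congr (_ * _); rewrite -natr_sum -big_mkcondr /= sum1_card.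
  by congr _%:R; apply: eq_card => x; rewrite inE andbA.
rewrite exchange_big /=; under eq_bigr => k _ do rewrite cE.
rewrite !big_ord_recl big_ord0 /= w2E expr0 expr1 !rmorphB /=.
by rewrite -!pmulrn; ring.
Qed.

Lemma gauss_chi_mul_conj :
  gauss (chi w) psi * gauss (chi (w ^+ 2)) psi = p%:R.
Proof.
have -> := gauss_mul_conj psiD psi0 psi1 (chi_mulchar w3) (chi_mulchar w23) g0 chi_g_neq1 chi_conj.
by rewrite chi_m1 mul1r card_Fp.
Qed.

(** The square of the Gauss sum is the Jacobi sum times the Gauss sum of [chi ^ 2], the conjugate of
    [chi]; one more factor turns the two conjugate Gauss sums into [p]. *)
Lemma gauss_chi_cube :
  gauss (chi w) psi ^+ 3 = p%:R * (jacobi_a%:~R + jacobi_b%:~R * w).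
Proof.
have cg2 : chi w g * chi w g != 1.
  rewrite -expr2; apply: contra_neq chi_g_neq1 => h.
  by have := chi_cube g0; rewrite exprS h mulr1.
rewrite exprSr expr2 (gauss_mul psiD (chi_mulchar w3) (chi_mulchar w3) g0 cg2).
rewrite jacobi_chi -gauss_chi_mul_conj.
have -> : gauss (fun x => chi w x * chi w x) psi = gauss (chi (w ^+ 2)) psi.
  by apply: eq_bigr => x _; rewrite -chi_sqr.
by ring.
Qed.

End Field.

Lemma prim_root3_sqr (F : fieldType) (w : F) :
  3.-primitive_root w -> 3.-primitive_root (w ^+ 2).
Proof. by move=> wP; rewrite (prim_root_exp_coprime 2 wP). Qed.

(** In [algC], multiplying the cube formula by its conjugate gives [p ^ 3] on one side and [p ^ 2]
    times the norm of the Jacobi sum on the other. *)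
Lemma jacobi_norm : jacobi_a ^+ 2 - jacobi_a * jacobi_b + jacobi_b ^+ 2 = p%:Z.
Proof.
have p0 : (p%:R : algC) != 0 by rewrite Num.Theory.pnatr_eq0 -lt0n prime_gt0.
have [w wP] := C_prim_root_exists (isT : 0 < 3)%N.
have [z zP] := C_prim_root_exists (prime_gt0 pP).
have e1 := gauss_chi_cube zP wP.
have e2 := gauss_chi_cube zP (prim_root3_sqr wP).
have e12 := gauss_chi_mul_conj zP wP.
have w0 := cube_root_sum wP.
apply: (@intr_inj algC); rewrite rmorphD rmorphB !rmorphM /= -pmulrn.
set a := jacobi_a%:~R in e1 e2 *; set b := jacobi_b%:~R in e1 e2 *.
have e3 : p%:R ^+ 3 = (p%:R * (a + b * w)) * (p%:R * (a + b * w ^+ 2)) :> algC.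
  by rewrite -e1 -e2 -exprMn e12.
apply: (mulfI p0); apply: (mulfI p0).
transitivity (p%:R ^+ 3 : algC); last by ring.
rewrite e3; have -> : w ^+ 2 = -1 - w by apply/eqP; rewrite -subr_eq0 -w0; apply/eqP; ring.
have -> : p%:R * (a + b * w) * (p%:R * (a + b * (-1 - w)))
  = p%:R * (p%:R * (a^+2 - a * b + b^+2)) - p%:R ^+2 * b^+2 * (1 + w + w ^+ 2) by ring.
by rewrite w0 mulr0 subr0; ring.
Qed.

Lemma cube_addr_root3 (F : fieldType) (U w : F) : 3.-primitive_root w ->
  (U + w) ^+ 3 = (U ^+ 3 - 3 * U + 1) + 3 * (U ^+ 2 - U) * w.
Proof.
move=> wP; transitivity (U ^+ 3 + 3 * U ^+ 2 * w + 3 * U * w ^+ 2 + w ^+ 3); first by ring.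
have -> : w ^+ 2 = -1 - w.
  by apply/eqP; rewrite -subr_eq0 -(cube_root_sum wP); apply/eqP; ring.
by rewrite (prim_expr_order wP); ring.
Qed.

Lemma cubf_chi (F : fieldType) (w z : F) (q : nat) (u : int) :
    q \in [pchar F] -> 3.-primitive_root w -> p.-primitive_root z ->
    q%:R != 0 :> 'F_p -> p%:R != 0 :> F -> (q %% 3 != 0)%N ->
  (cubf jacobi_a jacobi_b u)%:~R = 0 :> F -> chi w (q%:R) = 1.
Proof.
move=> qF wP zP q0 p0 q3; rewrite cubf_intr.
set a : F := jacobi_a%:~R; set b : F := jacobi_b%:~R; set U : F := u%:~R => f0.
have w2P := prim_root3_sqr wP.
have w0 := cube_root_sum wP; have w3 := prim_expr_order wP.
have w4E : w ^+ 2 ^+ 2 = w by rewrite -exprM exprS w3 mulr1.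
have e12 := gauss_chi_mul_conj zP wP.
have e1 := gauss_chi_cube zP wP; have e2 := gauss_chi_cube zP w2P.
rewrite -/a -/b in e1 e2.
have c1 := cube_addr_root3 U wP; have c2 := cube_addr_root3 U w2P.
have [v w2E] : exists v, w ^+ 2 = v by eexists.
rewrite w2E in w2P w0 w4E e12 e2 c2.
set G := gauss (chi w) (psi z) in e12 e1; set G' := gauss (chi v) (psi z) in e12 e2.
(* The difference of the two sides is [p * (w - v)] times the value of the cubic form, which is zero
   in [F]. *)
have conjE : (G * (U + w)) ^+ 3 = (G' * (U + v)) ^+ 3.
  rewrite !exprMn e1 e2 -!mulrA; congr (_ * _); rewrite c1 c2.
  apply/eqP; rewrite -subr_eq0; apply/eqP.
  transitivity ((a * (3 * (U ^+ 2 - U)) + b * (U ^+ 3 - 3 * U + 1)) * (w - v)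
    + b * (3 * (U ^+ 2 - U)) * (w ^+ 2 - v ^+ 2)); first by ring.
  rewrite w2E w4E -[RHS](mul0r (w - v)) -f0. ring.
have G0 : G != 0 by apply: contra_neq p0 => h; rewrite -e12 h mul0r.
have G'0 : G' != 0 by apply: contra_neq p0 => h; rewrite -e12 h mulr0.
have wv : w != v.
  by rewrite -w2E -{1}[w]expr1 (eq_prim_root_expr wP).
(* If one side of [conjE] vanished, so would the other; then [U = - w = - v], against [w != v]. *)
have h'0 : G' * (U + v) != 0.
  apply/negP => /eqP h'0; move: conjE; rewrite h'0 expr0n => /eqP.
  rewrite expf_eq0 /= mulf_eq0 (negPf G0) /= addr_eq0 => /eqP Uw.
  move/eqP: h'0; rewrite mulf_eq0 (negPf G'0) /= Uw addrC subr_eq0 eq_sym.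
  by rewrite (negPf wv).
(* Being a cube root of unity, [t] is sent by Frobenius to [t ^+ (q %% 3)]. *)
pose t := (G * (U + w)) / (G' * (U + v)).
have t3 : t ^+ 3 = 1 by rewrite expr_div_n conjE divff // expf_neq0.
have hE : G * (U + w) = t * (G' * (U + v)) by rewrite mulfVK. clearbody t.
have [c0 c0E] : exists c, c = chi w q%:R by eexists.
have c3 : c0 ^+ 3 = 1 by rewrite c0E chi_cube.
have ccE : chi v q%:R = c0 ^+ 2 by rewrite -w2E c0E chi_sqr.
have FU x : (U + x) ^+ q = U + x ^+ q.
  by rewrite -!(pFrobenius_autE qF) rmorphD /= rmorph_int.
have xq (x : F) : x ^+ 3 = 1 -> x ^+ q = x ^+ (q %% 3) by move=> x3; rewrite expr_mod.
have v3 : v ^+ 3 = 1 := prim_expr_order w2P.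
have hq : (G * (U + w)) ^+ q = t ^+ (q %% 3) * (G' * (U + v)) ^+ q.
  by rewrite hE exprMn (xq t).
have frob (x y : F) : 3.-primitive_root x -> 3.-primitive_root y -> x ^+ (q %% 3) = y ->
    chi y q%:R * gauss (chi x) (psi z) ^+ q = gauss (chi y) (psi z).
  move=> xP yP xy; apply: (gauss_frobenius (psiD zP) (psi0 z) qF q0).
    exact: chi_mulchar (prim_expr_order yP).
  move=> s; rewrite /chi; case: eqP => _; last first.
    by rewrite -exprM mulnC exprM xq ?xy ?(prim_expr_order xP).
  by rewrite expr0n gtn_eqF // prime_gt0 // (pcharf_prime qF).
(* Together with [c0 ^ 3 = 1], the equality [c0 = c0 ^ 2] forces [c0 = 1]. *)
suff [X X0 cX] : exists2 X, X != 0 & c0 * X = c0 ^+ 2 * X.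
  have cc := mulIf X0 cX.
  by rewrite -c0E -c3 exprS -cc -expr2 -cc.
have t0 : t != 0 by apply: contra_eq_neq t3 => ->; rewrite expr0n eq_sym oner_neq0.
have : (q %% 3)%N = 1%N \/ (q %% 3)%N = 2%N.
  by move: q3 (ltn_pmod q (isT : 0 < 3)%N); case: (q %% 3)%N => [|[|[|]]] //; [left|right].
case=> qm; rewrite qm in hq frob xq.
(* For [q] congruent to 1, Frobenius fixes [w], [v] and [t]. Raising [hE] to the power [q] and
   restoring [G] and [G'] multiplies the two sides by [c0] and [c0 ^ 2]. *)
- have f1 := frob w w wP wP (expr1 _); have f2 := frob v v w2P w2P (expr1 _).
  rewrite -/G -/G' -c0E ?ccE in f1 f2.
  rewrite !exprMn !FU (xq w) // (xq v) // in hq; rewrite !expr1 in hq.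
  exists (G ^+ q * (U + w)).
    by rewrite mulf_neq0 ?expf_neq0 //; apply: contraNneq h'0 => h;
       rewrite -(mulrI_eq0 _ (mulfI t0)) -hE h mulr0.
  rewrite mulrA f1 hE -{1}f2 hq. ring.
(* For [q] congruent to 2, Frobenius swaps [w] with [v] and, up to the factors [c0] and [c0 ^ 2],
   [G] with [G']; it sends [t] to [t ^ 2], and the powers of [t] combine to [t ^ 3 = 1]. *)
- have f1 := frob w v wP w2P w2E; have f2 := frob v w w2P wP w4E.
  rewrite -/G -/G' -c0E ?ccE in f1 f2.
  rewrite !exprMn !FU (xq w) // (xq v) // w2E w4E in hq.
  exists (G' ^+ q * (U + w)).
    by rewrite mulf_neq0 ?expf_neq0 //; apply: contraNneq h'0 => h;
       rewrite -(mulrI_eq0 _ (mulfI t0)) -hE h mulr0.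
  rewrite mulrA f2 hE -{1}f1.
  transitivity (t * c0 ^+ 2 * (G ^+ q * (U + v))); first by ring.
  by rewrite hq -[RHS]mul1r -t3; ring.
Qed.

(** A primitive root of unity of order [3 * p] in characteristic [q] supplies both the values of the
    cubic character and those of the additive one, so [cubf_chi] applies. *)
Lemma cubf_index (q : nat) (u : int) :
    prime q -> q != 3 -> q != p -> (q%:Z %| cubf jacobi_a jacobi_b u)%Z ->
  q%:R != 0 :> 'F_p /\ ind (q%:R) = 0%N %[mod 3].
Proof.
move=> qP qn3 qnp qdvd.
have c3 : coprime q 3 by rewrite prime_coprime // (@dvdn_prime2 q 3).
have cp : coprime q p by rewrite prime_coprime // dvdn_prime2.
have q0 : q%:R != 0 :> 'F_p.
  by rewrite -(dvdn_pcharf (pchar_Fp pP)) dvdn_prime2 // eq_sym.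
split=> //.
have [||F [x [qF xP]]] := @pchar_prim_root q (3 * p)%N qP.
  by rewrite coprimeMr c3.
  by rewrite muln_gt0 (prime_gt0 pP).
have wP := dvdn_prim_root xP (dvdn_mulr p (dvdnn 3)).
have zP := dvdn_prim_root xP (dvdn_mull 3 (dvdnn p)).
suff : chi (x ^+ (3 * p %/ 3)%N) q%:R == 1.
  by rewrite chi_mod // -(expr0 (x ^+ (3 * p %/ 3)%N)) (eq_prim_root_expr wP) modn_mod => /eqP.
apply/eqP/(cubf_chi (u := u) qF wP zP q0).
- by rewrite -(dvdn_pcharf qF) dvdn_prime2.
- by rewrite -/(dvdn 3 q) dvdn_prime2 // eq_sym.
- have /dvdzP[m ->] := qdvd.
  by rewrite intrM -pmulrn (pcharf0 qF) mulr0.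
Qed.

End CubicCharacter.

(** This is all that the remaining argument uses of the Gauss sums: an index divisible by 3 makes
    [q] a cube modulo [p]. *)
Lemma cubic_form_residue (p : nat) : prime p -> p = 1%N %[mod 3] ->
  exists a b : int, a ^+ 2 - a * b + b ^+ 2 = p%:Z /\
    forall (q : nat) (u : int), prime q -> q != 3 -> q != p ->
      (q%:Z %| cubf a b u)%Z -> cubic_residueb q p.
Proof.
move=> pP p3.
have [ind [indM [g g0 ig] indC]] := cubic_index pP p3.
exists (jacobi_a ind), (jacobi_b ind); split; first exact: (jacobi_norm pP indM g0 ig).
move=> q u qP qn3 qnp qd.
have [q0 iq] := cubf_index pP indM g0 ig qP qn3 qnp qd.
have [y y0 qy] := indC _ q0 iq.
apply/cubic_residueP; first exact: prime_gt0.
exists (y : nat); split.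
  rewrite gtnNdvd ?lt0n //; last by rewrite -{2}(Fp_cast pP) ltn_ord.
rewrite -!(val_Fp_nat pP); congr nat_of_ord; rewrite qy natrX.
by congr (_ ^+ _); apply: val_inj; rewrite /= val_Fp_nat // modn_small // -{2}(Fp_cast pP) ltn_ord.
Qed.

End CubicForm.

(** * Solutions of the cubic congruence modulo prime powers *)

Section FormArithmetic.
Local Open Scope ring_scope.

(* The roots of [cubf a b] are permuted by [v |-> 1 / (1 - v)], which has order
   three; [cross u v] vanishes when [u] is in the orbit of [v]. *)
Definition cross (u v : int) : int := (u - v) * ((u * v - v + 1) * (u * v - u + 1)).

(** The form is linear in [b] and [3 * a], and [cross u v] is the determinant of the system given by
    its values at [u] and [v]. Eliminating [a] gives this identity; eliminating [b] gives the next
    one. *)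
Lemma cubf_crossb (a b u v : int) :
  b * cross u v = cubf a b u * (v ^+ 2 - v) - cubf a b v * (u ^+ 2 - u).
Proof. by rewrite /cross /cubf; ring. Qed.

Lemma cubf_crossa (a b u v : int) :
  3 * a * cross u v = cubf a b v * (u ^+ 3 - 3 * u ^+ 2 + 1)
                      - cubf a b u * (v ^+ 3 - 3 * v ^+ 2 + 1).
Proof. by rewrite /cross /cubf; ring. Qed.

Variables (p : nat) (a b : int).
Hypotheses (pP : prime p) (ab : a ^+ 2 - a * b + b ^+ 2 = p%:Z).

Lemma normE_ndvd (q : nat) : prime q -> ~~ ((q %| a)%Z && (q %| b)%Z).
Proof.
move=> qP; apply/negP => /andP[/dvdzP[x ax] /dvdzP[y bx]].
have : (q ^ 2 %| p)%N.
  suff : ((q ^ 2)%N%:Z %| p%:Z)%Z by [].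
  apply/dvdzP; exists (x ^+ 2 - x * y + y ^+ 2).
  by rewrite -ab ax bx -mulnn PoszM; ring.
move=> q2p; have /eqP qp : q == p.
  by rewrite -dvdn_prime2 //; apply: dvdn_trans q2p; rewrite -mulnn dvdn_mulr.
by move: (dvdn_leq (prime_gt0 pP) q2p) (prime_gt1 pP); rewrite qp; clear; nia.
Qed.

(** Since [q] cannot divide both [a] and [b], one of the two elimination identities can be
    cancelled; [q != 3] disposes of the factor 3. *)
Lemma cross_dvd (q k : nat) (u v : int) : prime q -> q != 3 ->
    ((q ^ k)%N %| cubf a b u)%Z -> ((q ^ k)%N %| cubf a b v)%Z ->
  ((q ^ k)%N %| cross u v)%Z.
Proof.
move=> qP q3 du dv.
have cop (x : int) : ~~ (q %| x)%Z -> coprimez (q ^ k)%N x.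
  by move=> nx; rewrite coprimezE /= coprimeXl // prime_coprime.
have db : ((q ^ k)%N %| b * cross u v)%Z.
  by rewrite (cubf_crossb a) rpredB // dvdz_mulr.
have da : ((q ^ k)%N %| 3 * a * cross u v)%Z.
  by rewrite (cubf_crossa a b) rpredB // dvdz_mulr.
have := normE_ndvd qP; rewrite negb_and => /orP[na|nb].
- have n3 : ~~ (q %| 3%:Z)%Z by rewrite dvdzE /= dvdn_prime2.
  by move: da; rewrite -mulrA (Gauss_dvdzr _ (cop _ n3)) (Gauss_dvdzr _ (cop _ na)).
- by move: db; rewrite (Gauss_dvdzr _ (cop _ nb)).
Qed.

(** If [q] divided [u ^ 2 - u + 1], then [- u] would act as [w] modulo [q], and [p] would factor as
    [(a - b * u) * (a + b * (u - 1))] modulo [q]. The form is [-3] times the second factor there, so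
    [q] would divide [p]. *)
Lemma norm_coprime_cubf (q : nat) (u : int) : prime q -> q != 3 -> q != p ->
  (q %| cubf a b u)%Z -> ~~ (q %| u ^+ 2 - u + 1)%Z.
Proof.
move=> qP q3 qp du; apply/negP => dn.
have n3 : coprimez q 3.
  by rewrite coprimezE /= prime_coprime // dvdn_prime2.
have d1 : (q %| b * (u - 1) + a)%Z.
  rewrite -(Gauss_dvdzr _ n3).
  have -> : 3 * (b * (u - 1) + a) = (b * (u - 2) + 3 * a) * (u ^+ 2 - u + 1) - cubf a b u.
    by rewrite /cubf; ring.
  by rewrite rpredB // dvdz_mull.
have : (q%:Z %| p%:Z)%Z.
  have -> : p%:Z = (b * (u - 1) + a) * (a - b * u) + b ^+ 2 * (u ^+ 2 - u + 1).
    by rewrite -ab; ring.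
  by apply: rpredD; [apply: dvdz_mulr | apply: dvdz_mull].
by rewrite dvdzE /= dvdn_prime2 // (negPf qp).
Qed.

(** For [k = 1] this is Euclid's lemma. Otherwise two factors of [cross u v] sharing the prime [q]
    would make [q] divide [u ^ 2 - u + 1], so the whole power [q ^ k] falls on one factor. *)
Lemma cross_dvd_or (q k : nat) (u v : int) : prime q -> (0 < k)%N ->
    (k == 1%N) || ~~ (q %| u ^+ 2 - u + 1)%Z -> ((q ^ k)%N %| cross u v)%Z ->
  [|| ((q ^ k)%N %| u - v)%Z, ((q ^ k)%N %| u * v - v + 1)%Z
    | ((q ^ k)%N %| u * v - u + 1)%Z].
Proof.
move=> qP k0; rewrite /cross.
have Eu (x y : int) : (q %| x * y)%Z = (q %| x)%Z || (q %| y)%Z.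
  by rewrite !dvdzE abszM Euclid_dvdM.
case: eqP => [->|_ /=] h; first by rewrite expn1 !Eu.
have {h} n0 : ~~ (q %| u ^+ 2 - u + 1)%Z by [].
have split2 (x y : int) : ~~ ((q %| x)%Z && (q %| y)%Z) ->
    ((q ^ k)%N %| x * y)%Z -> ((q ^ k)%N %| x)%Z || ((q ^ k)%N %| y)%Z.
  have cop (z : int) : ~~ (q %| z)%Z -> coprimez (q ^ k)%N z.
    by move=> nz; rewrite coprimezE /= coprimeXl // prime_coprime.
  rewrite negb_and => /orP[nx|ny].
  - by rewrite (Gauss_dvdzr _ (cop _ nx)) => ->; rewrite orbT.
  - by rewrite (Gauss_dvdzl _ (cop _ ny)) => ->.
move=> d; have nd1 : ~~ ((q %| u - v)%Z && (q %| (u * v - v + 1) * (u * v - u + 1))%Z).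
  apply: contra n0 => /andP[h1]; rewrite Eu => /orP[h2|h2].
  - have -> : u ^+ 2 - u + 1 = (u * v - v + 1) + (u - 1) * (u - v) by ring.
    by rewrite rpredD // dvdz_mull.
  - have -> : u ^+ 2 - u + 1 = (u * v - u + 1) + u * (u - v) by ring.
    by rewrite rpredD // dvdz_mull.
have nd2 : ~~ ((q %| u * v - v + 1)%Z && (q %| u * v - u + 1)%Z).
  apply: contra n0 => /andP[h1 h2].
  have -> : u ^+ 2 - u + 1 = (u * v - v + 1) + (u - 1) * ((u * v - v + 1) - (u * v - u + 1)) by ring.
  by rewrite rpredD // dvdz_mull // rpredB.
have /orP[->//|/(split2 _ _ nd2)/orP[->|->]] := split2 _ _ nd1 d; by rewrite ?orbT.
Qed.

Lemma card_cong (N d : nat) (P : pred nat) : (0 < d)%N ->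
    (forall i j, P i -> P j -> i = j %[mod d]) ->
  (#|[set i : 'I_N | P i]| <= (N %/ d).+1)%N.
Proof.
move=> d0 Pd; pose f (i : 'I_N) : 'I_(N %/ d).+1 := inord (i %/ d).
have fE i : (f i = i %/ d :> nat)%N.
  by rewrite inordK // ltnS leq_div2r // ltnW.
rewrite -(@card_in_imset _ _ f); first by rewrite -[X in (_ <= X)%N]card_ord max_card.
move=> i j; rewrite !inE => Pi Pj fij; apply: val_inj => /=.
by rewrite (divn_eq i d) (divn_eq j d) -!fE fij (Pd _ _ Pi Pj).
Qed.

(** Fix one solution [i0]. Every solution satisfies one of three congruences linear in [u i], and
    each of these confines [i] to a single class modulo [q ^ k], the step 3 of the progression being
    invertible. *)
Lemma card_cubf_dvd (N c q k : nat) : prime q -> q != 3 -> (0 < k)%N ->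
    (k == 1%N) || (q != p) ->
  (#|[set i : 'I_N | ((q ^ k)%N %| cubf a b (3 * i + c)%N%:Z)%Z]|
     <= 3 * (N %/ q ^ k).+1)%N.
Proof.
move=> qP q3 k0 kp; set A := [set i | _].
have [->|[i0 i0A]] := set_0Vmem A; first by rewrite cards0.
pose u (i : nat) : int := (3 * i + c)%N%:Z.
pose P1 i := ((q ^ k)%N %| u i0 - u i)%Z.
pose P2 i := ((q ^ k)%N %| u i0 * u i - u i + 1)%Z.
pose P3 i := ((q ^ k)%N %| u i0 * u i - u i0 + 1)%Z.
have d0 : (0 < q ^ k)%N by rewrite expn_gt0 prime_gt0.
have qd : (q%:Z %| (q ^ k)%N%:Z)%Z by rewrite dvdzE /= dvdn_exp.
have c3 : coprimez (q ^ k)%N 3.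
  by rewrite coprimezE /= coprimeXl // prime_coprime // dvdn_prime2.
have cong i j : ((q ^ k)%N %| u i - u j)%Z -> i = j %[mod q ^ k]%N.
  have -> : u i - u j = 3 * (i%:Z - j%:Z) by rewrite /u; lia.
  rewrite (Gauss_dvdzr _ c3) -eqz_mod_dvd => /eqP h.
  by apply/eqP; rewrite -eqz_nat -!modz_nat h.
have lin (l m : int) i j : ~~ (q %| l)%Z ->
    ((q ^ k)%N %| l * u i + m)%Z -> ((q ^ k)%N %| l * u j + m)%Z -> i = j %[mod q ^ k]%N.
  move=> nl hi hj; apply: cong.
  have cl : coprimez (q ^ k)%N l by rewrite coprimezE /= coprimeXl // prime_coprime.
  rewrite -(Gauss_dvdzr _ cl).
  have -> : l * (u i - u j) = (l * u i + m) - (l * u j + m) by ring.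
  exact: rpredB.
have n1 : ~~ (q%:Z %| (1%R : int))%Z by rewrite dvdzE /= dvdn1 gtn_eqF ?prime_gt1.
have c1 := @card_cong N (q ^ k) P1 d0.
have c2 := @card_cong N (q ^ k) P2 d0.
have c3' := @card_cong N (q ^ k) P3 d0.
apply: leq_trans (_ : #|[set i : 'I_N | P1 i] :|: ([set i : 'I_N | P2 i] :|: [set i : 'I_N | P3 i])| <= _)%N.
  apply/subset_leq_card/subsetP => i; rewrite !inE => iA.
  rewrite inE in i0A.
  apply: (@cross_dvd_or q k) => //; last exact: cross_dvd.
  case: (k =P 1%N) kp => //= _ qp; apply: norm_coprime_cubf => //.
  exact: dvdz_trans qd i0A.
apply: leq_trans (leq_card_setU _ _) _; rewrite mulSn; apply: leq_add.
  apply: c1 => i j h1 h2; apply: cong.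
  have -> : u i - u j = (u i0 - u j) - (u i0 - u i) by ring.
  exact: rpredB.
apply: leq_trans (leq_card_setU _ _) _; rewrite mulSn mul1n; apply: leq_add.
  apply: c2 => i j; rewrite /P2 => h1 h2; apply: (lin (u i0 - 1) 1).
  (* The leading coefficient is prime to [q], as otherwise the congruence itself would make [q]
     divide 1. *)
  - apply: contra n1 => h; have -> : 1 = (u i0 * u i - u i + 1) - (u i0 - 1) * u i by ring.
    by rewrite rpredB ?dvdz_mulr // (dvdz_trans qd).
  - by rewrite mulrBl mul1r.
  - by rewrite mulrBl mul1r.
apply: c3' => i j; rewrite /P3 => h1 h2; apply: (lin (u i0) (1 - u i0)).
- apply: contra n1 => h; have -> : 1 = (u i0 * u i - u i0 + 1) - u i0 * (u i - 1) by ring.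
  by rewrite rpredB ?dvdz_mulr // (dvdz_trans qd).
- by have -> : u i0 * u i + (1 - u i0) = u i0 * u i - u i0 + 1 by ring.
- by have -> : u i0 * u j + (1 - u i0) = u i0 * u j - u i0 + 1 by ring.
Qed.

End FormArithmetic.

(** * Size of the values and their divisibility by 9 *)

Section FormSize.
Local Open Scope ring_scope.

Lemma PoszX (m n : nat) : (m ^ n)%N%:Z = m%:Z ^+ n.
Proof. by elim: n => // n IH; rewrite expnS PoszM IH exprS. Qed.

Variables (p : nat) (a b : int).
Hypotheses (pP : prime p) (ab : a ^+ 2 - a * b + b ^+ 2 = p%:Z).

Lemma normE_neq0 : b != 0.
Proof.
apply/eqP => b0; move: ab; have -> : a ^+ 2 - a * b + b ^+ 2 = a ^+ 2 by rewrite b0; ring.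
have pp := pP => /(congr1 absz); rewrite abszX /= => pE.
have da : (`|a| %| p)%N by rewrite -pE dvdn_exp.
move/primeP: pp => [p1 /(_ _ da)/orP[]/eqP aE]; rewrite aE in pE.
  by rewrite -pE in p1.
by move: (prime_gt1 pP) pE; clear; nia.
Qed.

(* On this residue class modulo 3, the ramified prime 3 contributes at most one
   factor 3 to each value. *)
Lemma cubf_class : exists2 r, (r < 3)%N &
  forall i : nat, ~~ (9 %| cubf a b (3 * i + r)%N%:Z)%Z.
Proof.
have [/dvdzP[B bB]|nb] := boolP (3 %| b)%Z; last first.
  (* When 3 does not divide [b], the values at multiples of 3 are congruent to [b] modulo 3. *)
  exists 0%N => // i; apply: contra nb => d9.
  have d3 : (3 %| cubf a b (3 * i + 0)%N%:Z)%Z by apply: dvdz_trans d9.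
  have -> : b = cubf a b (3 * i + 0)%N%:Z
     - 3 * (b * (9 * i%:Z ^+ 3 - 9 * i%:Z ^+ 2) + a * ((3 * i%:Z) ^+ 2 - 3 * i%:Z)).
    by rewrite addn0 PoszM /cubf; ring.
  by rewrite rpredB // dvdz_mulr.
(* When 3 divides [b], it does not divide [a], and the values on the class of 2 are congruent to
   [6 * a] modulo 9. *)
exists 2%N => // i; have := normE_ndvd pP ab (isT : prime 3).
rewrite bB dvdz_mull // andbT; apply: contra => /dvdzP[m].
rewrite PoszD PoszM /cubf => e.
pose Y := B * (9 * i%:Z ^+ 3 + 9 * i%:Z ^+ 2 - 1) + 3 * a * (i%:Z ^+ 2 + i%:Z).
apply/dvdzP; exists (a - m + Y); apply: (@mulfI _ 3) => //.
have -> : 3 * ((a - m + Y) * 3%:Z) = 9 * (a + Y) - m * 9%:Z by ring.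
by rewrite -e /Y; ring.
Qed.

(** Positivity of the quadratic form bounds [a], [b] and [a - b] by the square root of [2 * p].
    Written with coefficients [b], [3 * (a - b)], [- 3 * a] and [b], the form is then dominated by
    the binomial expansion of [(u + 1) ^ 3]. *)
Lemma cubf_upper (u : nat) :
  (`|cubf a b u| ^ 2 <= 2 * p * u.+1 ^ 6)%N.
Proof.
have [m [m0 m2 [ha hb hab]]] : exists m : int, [/\ 0 <= m, m ^+ 2 <= 2 * p%:Z &
    [/\ `|a| <= m, `|b| <= m & `|a - b| <= m]].
  have sq (x y : int) : x ^+ 2 - x * y + y ^+ 2 = p%:Z -> `|x| ^+ 2 <= 2 * p%:Z.
    by rewrite real_normK ?num_real // => <-; nia.
  exists (Num.max `|a| (Num.max `|b| `|a - b|)); rewrite !le_max !lexx ?orbT.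
  split=> //.
  have sa := sq a b ab.
  have sb : `|b| ^+ 2 <= 2 * p%:Z by apply: (sq b a); rewrite -ab; ring.
  have sc : `|a - b| ^+ 2 <= 2 * p%:Z by apply: (sq (a - b) (- b)); rewrite -ab; ring.
  by rewrite !maxEle; do !case: ifP.
have fm : `|cubf a b u| <= m * (u%:Z + 1) ^+ 3.
  have -> : cubf a b u = b * (u%:Z ^+ 3 + 1) + 3 * u%:Z ^+ 2 * (a - b) - 3 * u%:Z * a.
    by rewrite /cubf; ring.
  have -> : m * (u%:Z + 1) ^+ 3 = m * (u%:Z ^+ 3 + 1) + 3 * u%:Z ^+ 2 * m + 3 * u%:Z * m by ring.
  have u3 : 0 <= u%:Z ^+ 3 + 1 by rewrite addr_ge0 // exprn_ge0.
  apply: le_trans (ler_normB _ _) _; apply: lerD; last first.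
    by rewrite normrM ger0_norm ?mulr_ge0 // ler_wpM2l ?mulr_ge0.
  apply: le_trans (ler_normD _ _) _; apply: lerD.
    by rewrite normrM (ger0_norm u3) ler_wpM2r.
  by rewrite normrM ger0_norm ?mulr_ge0 ?exprn_ge0 // ler_wpM2l ?mulr_ge0 ?exprn_ge0.
have f2 : `|cubf a b u| ^+ 2 <= 2 * p%:Z * (u%:Z + 1) ^+ 6.
  apply: (le_trans (_ : _ <= (m * (u%:Z + 1) ^+ 3) ^+ 2)).
    by rewrite lerXn2r // nnegrE ?normr_ge0 // mulr_ge0 // exprn_ge0.
  by rewrite exprMn -exprM ler_wpM2r // exprn_ge0.
by rewrite -lez_nat PoszX (PoszM (2 * p)%N) (PoszM 2) PoszX abszE -[u.+1]addn1 PoszD.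
Qed.

(** Two small values at distinct points would make [b * cross u v] less than [18 * N ^ 4] by
    elimination, while the factors of [cross u v] have size at least 1, [6 * N ^ 2] and
    [6 * N ^ 2]. *)
Lemma cubf_lower (N i j r : nat) : (i < N)%N -> (j < N)%N -> (r < 3)%N ->
    (4 * `|cubf a b (3 * (N + i) + r)%N%:Z| < N ^ 2)%N ->
    (4 * `|cubf a b (3 * (N + j) + r)%N%:Z| < N ^ 2)%N -> i = j.
Proof.
move=> iN jN r3; rewrite -!ltz_nat !(PoszM 4) PoszX !abszE.
set u := (3 * (N + i) + r)%N%:Z; set v := (3 * (N + j) + r)%N%:Z => hu hv.
apply/eqP/negPn/negP => ij.
have [n nE] : exists n : int, n = N%:Z by eexists.
rewrite -nE in hu hv.
have [n1 [u1 u2] [v1 v2] uv] : [/\ 1 <= n, 3 * n <= u /\ u <= 6 * n, 3 * n <= v /\ v <= 6 * n & u != v].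
  by rewrite nE /u /v; split; [|split|split|]; lia.
have low : 36 * (n ^+ 2 * n ^+ 2) <= `|cross u v|.
  have h (x y : int) : 3 * n <= x -> 3 * n <= y -> 6 * n ^+ 2 <= x * y - y + 1.
    move=> hx hy; have : 0 <= (x - 3 * n) * (y - 1) by rewrite mulr_ge0; lia.
    have : 0 <= (y - 3 * n) * (3 * n - 1) by rewrite mulr_ge0; lia.
    have : 0 <= n * (n - 1) by rewrite mulr_ge0; lia.
    by clear; nia.
  have huv := h u v u1 v1; have hvu := h v u v1 u1; rewrite [v * u]mulrC in hvu.
  have n2 : 0 <= n ^+ 2 by rewrite exprn_ge0; lia.
  rewrite /cross normrM -[X in X <= _]mul1r; apply: ler_pM => //.
  - by apply: mulr_ge0 => //; apply: mulr_ge0.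
  - by move: uv; clear; lia.
  have -> : 36 * (n ^+ 2 * n ^+ 2) = (6 * n ^+ 2) * (6 * n ^+ 2) by ring.
  have n6 : 0 <= 6 * n ^+ 2 by apply: mulr_ge0.
  rewrite normrM; apply: ler_pM => //.
    exact: le_trans huv (ler_norm _).
  exact: le_trans hvu (ler_norm _).
have up (x : int) : 3 * n <= x -> x <= 6 * n -> 0 <= x ^+ 2 - x <= 36 * n ^+ 2.
  move=> h1 h2; have : 0 <= x * (x - 1) by rewrite mulr_ge0; lia.
  have : 0 <= (6 * n - x) * (6 * n + x) by rewrite mulr_ge0; lia.
  by clear -n1 h1; move=> k1 k2; apply/andP; split; nia.
have key : `|cross u v| <= `|cubf a b u| * (36 * n ^+ 2) + `|cubf a b v| * (36 * n ^+ 2).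
  apply: (@le_trans _ _ (`|b * cross u v|)).
    by rewrite [X in _ <= X]normrM ler_peMl // -gtz0_ge1 normr_gt0 normE_neq0.
  have /andP[v3 v4] := up v v1 v2; have /andP[u3 u4] := up u u1 u2.
  rewrite (cubf_crossb a); apply: le_trans (ler_normB _ _) _.
  by rewrite !normrM (ger0_norm v3) (ger0_norm u3) lerD // ler_wpM2l.
have n2 : 0 < n ^+ 2 by rewrite exprn_gt0; lia.
move: low key hu hv n2; clear.
move: `|cubf a b u| `|cubf a b v| `|cross u v| (n ^+ 2) => X Y W m low key hX hY m0.
have : 0 < (m - 4 * X + m - 4 * Y) * m by rewrite mulr_gt0 //; lia.
by nia.
Qed.

End FormSize.

(** * Valuations of a product of values, and the resulting count of primes *)

Lemma leq_exp2r_weak m n e : m <= n -> m ^ e <= n ^ e.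
Proof. by case: e => // e mn; rewrite leq_exp2r. Qed.

Lemma fact_leq_exp n : n`! <= n ^ n.
Proof.
elim: n => // n IH; rewrite factS expnS leq_mul //.
exact: leq_trans IH (leq_exp2r_weak _ (leqnSn n)).
Qed.

Lemma logn_sum_dvd q n L : prime q -> 0 < n -> logn q n <= L ->
  logn q n = \sum_(1 <= k < L.+1) (q ^ k %| n).
Proof.
move=> qP n0 nL; rewrite (@big_cat_nat _ _ _ (logn q n).+1) //= -[LHS]addn0; congr (_ + _).
  rewrite -[LHS]subn0 -subSS -[LHS]muln1 -sum_nat_const_nat.
  by apply: eq_big_nat => k /andP[_ kn]; rewrite pfactor_dvdn // -ltnS kn.
rewrite big_nat big1 // => k /andP[nk _].
by rewrite pfactor_dvdn // leqNgt nk.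
Qed.

(** A truncated form of Legendre's formula; when [L] exceeds [M], the extra terms are zero. *)
Lemma sum_divn_leq_logn_fact q M L : prime q ->
  \sum_(1 <= k < L.+1) M %/ q ^ k <= logn q M`!.
Proof.
move=> qP; rewrite logn_fact //.
apply: leq_trans (_ : _ <= \sum_(1 <= k < (M + L).+1) M %/ q ^ k) _.
  by rewrite [leqRHS](@big_cat_nat _ _ _ L.+1) ?leq_addr //= ltnS leq_addl.
rewrite (@big_cat_nat _ _ _ M.+1) //=; last by rewrite ltnS leq_addr.
rewrite [X in _ + X]big_nat [X in _ + X]big1 ?addn0 // => k /andP[Mk _].
by rewrite divn_small // (ltn_trans Mk) // ltn_expl // prime_gt1.
Qed.

Lemma prod_pfactor_dvd (S : seq nat) n : uniq S -> all prime S ->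
  \prod_(q <- S) q ^ logn q n %| n.
Proof.
elim: S => [|q S IH] /=; first by rewrite big_nil dvd1n.
move=> /andP[qS uS] /andP[qP pS]; rewrite big_cons Gauss_dvd ?pfactor_dvdnn ?IH //.
rewrite coprimeXl // big_seq; apply: (big_ind (coprime q)) => [|x y|r rS].
- exact: coprimen1.
- by move=> cx cy; rewrite coprimeMr cx.
- rewrite coprimeXr // prime_coprime // dvdn_prime2 ?(allP pS r rS) //.
  by apply: contraNneq qS => ->.
Qed.

(* Only the primes of [S] matter, so the valuations are compared with those of
   [M`!] for [M] much smaller than [N]: [N %/ q ^ k <= R * (M %/ q ^ k).+1]. *)
Lemma prod_valuation_bound (N M R X K : nat) (S : seq nat) (G : {set 'I_N})
    (F : nat -> nat) :
    N = M * R -> 0 < M -> 0 < X -> uniq S -> all prime S -> size S <= K ->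
    (forall i : 'I_N, i \in G -> 0 < F i <= X) ->
    (forall q k, q \in S -> 0 < k ->
       #|[set i : 'I_N | (i \in G) && (q ^ k %| F i)]| <= 3 * (N %/ q ^ k).+1) ->
    (forall i : 'I_N, i \in G -> F i <= 3 * \prod_(q <- S) q ^ logn q (F i)) ->
  \prod_(i in G) F i <= 3 ^ N * M ^ (3 * N) * X ^ (3 * R.+1 * K).
Proof.
move=> NE M0 X0 uS pS sS FX cardF Fdec.
(* Summing the number of multiples of [q ^ k] over [k] gives [R] copies of Legendre's sum for [M],
   plus a rounding term for each [k] with [q ^ k <= X]. *)
have val q : q \in S ->
    \sum_(i in G) logn q (F i) <= 3 * R * logn q M`! + 3 * R.+1 * trunc_log q X.
  move=> qS; have qP := allP pS q qS; set L := trunc_log q X.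
  apply: (@leq_trans (\sum_(i in G) \sum_(1 <= k < L.+1) (q ^ k %| F i))).
    apply: leq_sum => i iG; have /andP[F0 FiX] := FX i iG.
    rewrite {1}(@logn_sum_dvd q (F i) L) //.
    apply: trunc_log_max; first exact: prime_gt1.
    by apply: leq_trans FiX; rewrite dvdn_leq // pfactor_dvdnn.
  rewrite exchange_big /=.
  apply: (@leq_trans (\sum_(1 <= k < L.+1) (3 * R * (M %/ q ^ k) + 3 * R.+1))).
    rewrite big_nat [leqRHS]big_nat; apply: leq_sum => k /andP[k0 _].
    rewrite -big_mkcondr /= sum1_card.
    have -> : #|[pred i : 'I_N | (i \in G) && (q ^ k %| F i)]|
      = #|[set i : 'I_N | (i \in G) && (q ^ k %| F i)]|.
      by apply: eq_card => i; rewrite !inE.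
    apply: leq_trans (cardF q k qS k0) _.
    have d0 : 0 < q ^ k by rewrite expn_gt0 prime_gt0.
    have : N %/ q ^ k <= R * (M %/ q ^ k).+1.
      rewrite -[leqRHS](mulnK _ d0) leq_div2r // NE [M * R]mulnC -mulnA.
      by rewrite leq_mul2l ltnW ?orbT // ltn_ceil.
    by clear; nia.
  rewrite big_split /= -big_distrr /= sum_nat_const_nat subSS subn0.
  by rewrite [L * _]mulnC leq_add2r leq_mul2l sum_divn_leq_logn_fact ?orbT.
apply: (@leq_trans (\prod_(i in G) (3 * \prod_(q <- S) q ^ logn q (F i)))).
  exact: leq_prod.
rewrite big_split /= prod_nat_const exchange_big /= -mulnA; apply: leq_mul.
  by rewrite leq_exp2l // -[leqRHS]card_ord max_card.
under eq_bigr => q _ do rewrite -expn_sum.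
apply: (@leq_trans (\prod_(q <- S) (q ^ logn q M`!) ^ (3 * R) * \prod_(q <- S) X ^ (3 * R.+1))).
  rewrite -big_split /= big_seq [leqRHS]big_seq; apply: leq_prod => q qS.
  have qP := allP pS q qS.
  apply: (@leq_trans (q ^ (3 * R * logn q M`! + 3 * R.+1 * trunc_log q X))).
    by rewrite leq_exp2l ?prime_gt1 // val.
  rewrite expnD; apply: leq_mul; first by rewrite -expnM mulnC.
  by rewrite mulnC expnM leq_exp2r_weak // trunc_logP ?prime_gt1.
apply: leq_mul.
  have -> : \prod_(q <- S) (q ^ logn q M`!) ^ (3 * R) = (\prod_(q <- S) q ^ logn q M`!) ^ (3 * R).
    by elim: (S) => [|q s IH]; rewrite ?big_nil ?exp1n // !big_cons expnMn IH.
  (* The prime powers coming from distinct primes of [S] have a product dividing the factorial, so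
     all of [S] together contributes at most [M ^ M]. *)
  apply: (@leq_trans (M`! ^ (3 * R))).
    by apply: leq_exp2r_weak; rewrite dvdn_leq ?fact_gt0 // prod_pfactor_dvd.
  apply: (@leq_trans ((M ^ M) ^ (3 * R))).
    by apply: leq_exp2r_weak; exact: fact_leq_exp.
  by rewrite -expnM mulnCA -NE.
rewrite big_const_seq count_predT iter_muln_1 -expnM.
by rewrite leq_pexp2l // leq_mul2l sS orbT.
Qed.

(* With [M = K ^ 2] and [N = K ^ 9], the [K] primes contribute about
   [M ^ (3 * N) = K ^ (6 * N)] to a product of at least [N / 2] values of size
   [N ^ 2], that is to at least [N ^ N = K ^ (9 * N)]; the term [X ^ (6 * K ^ 8)]
   coming from rounding is negligible when [X ^ 3 < K ^ K]. *)
Lemma count_cubic_residues_gt (p K X : nat) : prime p -> p = 1 %[mod 3] ->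
    12 <= K -> 2 * p * (6 * K ^ 9) ^ 6 <= X ^ 2 -> X ^ 3 < K ^ K ->
  K < count (fun q => prime q && cubic_residueb q p) (iota 0 X.+1).
Proof.
move=> pP p3 K12 hX XK; rewrite ltnNge; apply/negP => few.
have [a [b [ab res]]] := cubic_form_residue pP p3.
have [r r3 class9] := cubf_class pP ab.
have K0 : 0 < K by apply: leq_trans K12.
have [N NE] : exists N, N = K ^ 9 by eexists.
have N0 : 0 < N by rewrite NE expn_gt0 K0.
(* The threshold 56 makes [1 + 3 * (N / 7 + 1)], a bound for the number of discarded indices, at
   most [N / 2]. *)
have N56 : 56 <= N.
  by rewrite NE; apply: leq_trans (leq_exp2r_weak 9 K12) => //; apply: leq_trans (leq_pexp2l _ (_ : 2 <= 9)).
pose u i := 3 * (N + i) + r.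
pose F i := absz (cubf a b (u i)%:Z).
have Fdvd d i : (d %| F i) = (d%:Z %| cubf a b (u i)%:Z)%Z by [].
(* Values divisible by [p] are discarded because nothing is claimed about [p] as a divisor of the
   form. *)
pose G := [set i : 'I_N | (N ^ 2 <= 4 * F i) && ~~ (p %| F i)].
pose S := [seq q <- iota 0 X.+1 | [&& prime q, cubic_residueb q p, q != 3 & q != p]].
have SP q : q \in S = [&& prime q, cubic_residueb q p, q != 3, q != p & q <= X].
  by rewrite mem_filter mem_iota add0n ltnS leq0n !andTb -!andbA.
have pn3 : p != 3 by apply: contra_eqN p3 => /eqP ->.
have p7 : 7 <= p.
  by case: p pP p3 {ab res hX few class9 pn3 Fdvd G S SP} => [|[|[|[|[|[|[|p]]]]]]].
have FX i : i < N -> F i <= X.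
  move=> iN; rewrite -leq_sqr; apply: leq_trans hX.
  apply: leq_trans (cubf_upper pP ab (u i)) _; rewrite leq_mul2l; apply/orP; right.
  by rewrite leq_exp2r // -NE /u; lia.
have F0 i : i \in G -> 0 < F i.
  by rewrite inE => /andP[_]; case: (F i) => //; rewrite dvdn0.
have X0 : 0 < X.
  have pos : 0 < 2 * p * (6 * K ^ 9) ^ 6.
    rewrite muln_gt0; apply/andP; split; first by rewrite muln_gt0 (prime_gt0 pP).
    by rewrite expn_gt0 muln_gt0 (expn_gt0 K) K0.
  by move: (leq_trans pos hX); rewrite expn_gt0 orbF.
have card_dvd q k : prime q -> q != 3 -> 0 < k -> (k == 1) || (q != p) ->
    #|[set i : 'I_N | q ^ k %| F i]| <= 3 * (N %/ q ^ k).+1.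
  move=> qP q3 k0 kp; apply: leq_trans (card_cubf_dvd pP ab N (3 * N + r) qP q3 k0 kp).
  apply/subset_leq_card/subsetP => i; rewrite !inE Fdvd /u.
  by have -> : 3 * (N + i) + r = 3 * i + (3 * N + r) by lia.
have Gbig : N <= 2 * #|G|.
  have cN : #|G| + #|~: G| = N by rewrite cardsC card_ord.
  have : #|~: G| <= 1 + 3 * (N %/ p).+1.
    apply: leq_trans (_ : #|[set i : 'I_N | 4 * F i < N ^ 2] :|: [set i : 'I_N | p ^ 1 %| F i]| <= _).
      by apply/subset_leq_card/subsetP => i; rewrite !inE expn1 negb_and negbK -ltnNge.
    apply: leq_trans (leq_card_setU _ _) _; apply: leq_add; last first.
      by rewrite -[X in _ %/ X]expn1 card_dvd.
    apply/card_le1_eqP => i j; rewrite !inE => hi hj; apply: val_inj => /=.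
    exact: (cubf_lower pP ab (ltn_ord j) (ltn_ord i) r3).
  have : N %/ p <= N %/ 7 by apply: leq_div2l.
  have := leq_trunc_div N 7.
  by move: cN N56; clear; lia.
have main := @prod_valuation_bound N (K ^ 2) (K ^ 7) X K S G F.
have {main}main : \prod_(i in G) F i <= 3 ^ N * (K ^ 2) ^ (3 * N) * X ^ (3 * (K ^ 7).+1 * K).
  apply: main.
  - by rewrite NE -expnD.
  - by rewrite expn_gt0 K0.
  - by [].
  - by rewrite filter_uniq // iota_uniq.
  - by apply/allP => q; rewrite SP => /andP[].
  - apply: leq_trans few; rewrite size_filter; apply: sub_count => q.
    by case/and4P => -> ->.
  - by move=> i iG; rewrite F0 //= FX.
  - move=> q k; rewrite SP => /and5P[qP _ q3 qp _] k0.
    apply: leq_trans (card_dvd q k qP q3 k0 _); last by rewrite qp orbT.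
    by apply/subset_leq_card/subsetP => i; rewrite !inE => /andP[].
  - move=> i iG; apply: dvdn_leq.
      rewrite muln_gt0 /= big_seq; apply: prodn_cond_gt0 => q.
      by rewrite SP => /andP[qP _]; rewrite expn_gt0 prime_gt0.
    (* Prime by prime: 3 occurs at most once by the choice of [r], and any other prime divisor is a
       cubic residue not exceeding [X], hence lies in [S]. *)
    apply/dvdn_partP; first exact: F0.
    move=> q; rewrite mem_primes => /and3P[qP _ qF]; rewrite p_part.
    have [->|q3] := eqVneq q 3.
      apply: dvdn_mulr; rewrite -[X in _ %| X]expn1 dvdn_exp2l // leqNgt -pfactor_dvdn ?F0 //.
      by rewrite Fdvd /u; apply: class9.
    have qp : q != p by apply: contraTneq iG => qp; rewrite inE -qp qF andbF.
    have qS : q \in S.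
      rewrite SP qP q3 qp (res q (Posz (u i))) //= (leq_trans _ (FX i (ltn_ord i))) //.
      by rewrite dvdn_leq // F0.
    by apply: dvdn_mull; rewrite (big_rem q) //= dvdn_mulr.
have {}main : (N ^ 2) ^ #|G| <= 4 ^ N * (3 ^ N * (K ^ 2) ^ (3 * N) * X ^ (3 * (K ^ 7).+1 * K)).
  apply: (@leq_trans (\prod_(i in G) (4 * F i))).
    rewrite -prod_nat_const; apply: leq_prod => i; rewrite inE => /andP[//].
  rewrite big_split /= prod_nat_const; apply: leq_mul => //.
  by rewrite leq_exp2l // -[leqRHS]card_ord max_card.
have {}main : N ^ N <= 12 ^ N * K ^ (6 * N) * X ^ (3 * (K ^ 7).+1 * K).
  apply: (@leq_trans ((N ^ 2) ^ #|G|)).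
    by rewrite -expnM leq_pexp2l.
  apply: leq_trans main _; rewrite !mulnA -expnMn -expnM !mulnA.
  by rewrite leqnn.
(* As [12 <= K], the constant [12 ^ N] costs only [K ^ N]; comparing [K ^ (9 * N)] with
   [K ^ (7 * N)] leaves [K ^ (2 * N)], which is [K ^ K] to the power [2 * K ^ 8]. *)
have {}main : K ^ (2 * N) <= X ^ (6 * K ^ 8).
  have : K ^ (2 * N) * K ^ (7 * N) <= X ^ (6 * K ^ 8) * K ^ (7 * N).
    rewrite -expnD -mulnDl -[2 + 7]/9 (expnM K 9 N) -NE.
    apply: leq_trans main _; rewrite mulnC; apply: leq_mul.
      apply: leq_pexp2l => //; rewrite (expnS K 7).
      have : 0 < K ^ 7 by rewrite expn_gt0 K0.
      by move: (K ^ 7) => z z1; clear -z1; nia.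
    by rewrite (mulSn 6 N) expnD leq_mul // leq_exp2r_weak.
  by rewrite leq_pmul2r // expn_gt0 K0.
have : (K ^ K) ^ (2 * K ^ 8) <= (X ^ 3) ^ (2 * K ^ 8).
  rewrite -!expnM (_ : K * (2 * K ^ 8) = 2 * N); last by rewrite NE mulnCA -expnS.
  by rewrite mulnA.
by rewrite leq_exp2r ?muln_gt0 ?expn_gt0 ?K0 // leqNgt XK.
Qed.

(** * Passage to real exponents and choice of parameters *)

Section RealAsymptotics.
Local Open Scope R_scope.

Lemma INR_muln (m n : nat) : INR (m * n)%N = INR m * INR n.
Proof. by rewrite -multE mult_INR. Qed.

Lemma INR_expn (m n : nat) : INR (m ^ n)%N = INR m ^ n.
Proof. by elim: n => // n IH; rewrite expnS INR_muln IH. Qed.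

Lemma leq_INR (m n : nat) : INR m <= INR n -> (m <= n)%N.
Proof. by move=> h; apply/ssrnat.leP/INR_le. Qed.

Lemma ltn_INR (m n : nat) : INR m < INR n -> (m < n)%N.
Proof. by move=> h; apply/ssrnat.ltP/INR_lt. Qed.

Lemma INR_up (x : R) : 0 < x -> x < INR (Z.to_nat (up x)) <= x + 1.
Proof.
move=> x0; have [h1 h2] := archimed x.
have up0 : Z.le 0 (up x) by apply: le_IZR; lra.
by rewrite INR_IZR_INZ Z2Nat.id //; lra.
Qed.

Lemma Rpower_INR_gt_root (p : nat) (eps B : R) : 0 < eps -> 0 < B ->
  Rpower B (30 / eps) < INR p -> B < Rpower (INR p) (eps / 30).
Proof.
move=> e0 B0 h.
have <- : Rpower (Rpower B (30 / eps)) (eps / 30) = B.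
  have ee : eps * / eps = 1 by apply: Rinv_r; lra.
  by rewrite Rpower_mult (_ : 30 / eps * (eps / 30) = 1) ?Rpower_1 //; lra.
apply: Rlt_Rpower_l; first lra.
by split=> //; apply: exp_pos.
Qed.

Lemma leq_count_cubic_prime_residues (p X : nat) (Y : R) : INR X < Y ->
  (count (fun q => prime q && cubic_residueb q p) (iota 0 X.+1)
     <= count_cubic_prime_residues p Y)%N.
Proof.
move=> XY; rewrite /count_cubic_prime_residues.
have Y0 : 0 < Y by have := pos_INR X; lra.
have XZ : (X.+1 <= Z.to_nat (up Y))%N by apply: ltn_INR; have := INR_up Y0; lra.
rewrite -(subnKC XZ) iotaD count_cat; apply: leq_trans (leq_addr _ _).
rewrite -!size_filter (_ : [seq q <- _ | _] = [seq q <- iota 0 X.+1 |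
  [&& prime q, (if Rlt_dec (INR q) Y then true else false) & cubic_residueb q p]]) //.
apply: eq_in_filter => q; rewrite mem_iota add0n ltnS => /andP[_ /ssrnat.leP/le_INR qX].
by case: Rlt_dec => // nqY; lra.
Qed.

End RealAsymptotics.

Theorem theorem1 :
  forall eps : R, Rlt 0 eps ->
  exists p0 : R,
    forall p : nat, prime p -> p = 1 %[mod 3] -> Rlt p0 (INR p) ->
      Rlt (Rpower (INR p) (Rdiv eps 30))
          (INR (count_cubic_prime_residues p
                  (Rpower (INR p) (Rplus (Rdiv 1 2) eps)))).
Proof.
Local Open Scope R_scope.
move=> eps e0.
pose c := 30 * (1 / 2 + eps) / eps.
(* [p ^ (1/2 + eps) = T ^ c] for [T = p ^ (eps / 30)]. *)
pose B := Rmax 6144 (3 * c).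
(* Here [6144 = 12 * 2 ^ 9]: with [K <= 2 * T] it yields [12 * K ^ 9 <= T ^ 10]. The other bound,
   [3 * c <= B], yields [Y ^ 3 = T ^ (3 * c) < T ^ K]. *)
have B1 : 6144 <= B by apply: Rmax_l.
have Bc : 3 * c <= B by apply: Rmax_r.
exists (Rpower B (30 / eps)) => p pP p3 hp.
have p0 : 0 < INR p by apply: lt_0_INR; apply/ssrnat.ltP; apply: prime_gt0.
have := @Rpower_INR_gt_root p eps B e0 ltac:(lra) hp.
set T := Rpower (INR p) (eps / 30) => BT.
set Y := Rpower (INR p) (1 / 2 + eps).
have T1 : 6144 < T by lra.
have YT : Y = Rpower T c.
  rewrite /T Rpower_mult /Y /c; congr Rpower.
  have ee : eps * / eps = 1 by apply: Rinv_r; lra.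
  have eee : eps * (eps * / eps) = eps by rewrite ee Rmult_1_r.
  lra.
have Y2 : Y ^ 2 = INR p * (T ^ 10) ^ 6.
  rewrite -pow_mult -!Rpower_pow; try lra; last exact: exp_pos.
  rewrite /T /Y !Rpower_mult -{2}(Rpower_1 (INR p)) // -Rpower_plus.
  by congr Rpower; rewrite !INR_IZR_INZ /=; lra.
have Y0 : 0 < Y by apply: exp_pos.
have Y4 : 2 < Y.
  have : 1 <= INR p by apply: (le_INR 1); apply/ssrnat.leP; apply: prime_gt0.
  have t10 : 2 <= T ^ 10.
    have := pow_R1_Rle T 9 ltac:(lra).
    rewrite -[T ^ 10]/(T * T ^ 9); nra.
  have := pow_incr 2 (T ^ 10) 6 ltac:(lra) => h.
  nra.
have T0 : 0 < T by lra.
have := INR_up T0; set K := Z.to_nat (up T) => KT.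
(* Halving [Y] leaves room for rounding up: [Y / 2 < X <= Y / 2 + 1 < Y], since [Y] exceeds 2. *)
have Yh : 0 < Y / 2 by lra.
have := INR_up Yh; set X := Z.to_nat (up (Y / 2)) => XY.
have XltY : INR X < Y by lra.
have core : (K < count (fun q => prime q && cubic_residueb q p) (iota 0 X.+1))%N.
  apply: count_cubic_residues_gt => //.
  - by apply: leq_INR; rewrite [INR 12]INR_IZR_INZ /=; lra.
  - apply: leq_INR; rewrite !(INR_muln, INR_expn) (_ : INR 2 = 2) // (_ : INR 6 = 6); last first.
      by rewrite INR_IZR_INZ.
    have k9 : INR K ^ 9 <= (2 * T) ^ 9 by apply: pow_incr; lra.
    have t9 : 0 <= T ^ 9 by apply: pow_le; lra.
    have k0 : 0 <= INR K ^ 9 by apply: pow_le; lra.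
    (* The spare factor 2 becomes 64 in the sixth power, more than the 8 needed for the 2 in [2 * p]
       and the 4 from squaring [Y / 2]. *)
    have h6 : (2 * (6 * INR K ^ 9)) ^ 6 <= (T ^ 10) ^ 6.
      apply: pow_incr; split; first lra.
      rewrite Rpow_mult_distr in k9; rewrite -[T ^ 10]/(T * T ^ 9).
      have e9 : 2 ^ 9 = 512 by lra.
      rewrite e9 in k9.
      nra.
    rewrite Rpow_mult_distr in h6.
    have x2 : (Y / 2) ^ 2 <= INR X ^ 2 by apply: pow_incr; lra.
    have hY : (Y / 2) ^ 2 = INR p * (T ^ 10) ^ 6 / 4 by rewrite -Y2; lra.
    move: (pow_le (6 * INR K ^ 9) 6 ltac:(lra)) h6 hY.
    move: ((6 * INR K ^ 9) ^ 6) ((T ^ 10) ^ 6) => z w z0 h6 hY.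
    have : 2 ^ 6 = 64 by lra.
    nra.
  - apply: ltn_INR; rewrite !INR_expn.
    apply: (Rle_lt_trans _ (Y ^ 3)).
      by apply: pow_incr; split; [exact: pos_INR | lra].
    apply: (Rlt_le_trans _ (T ^ K)); last by apply: pow_incr; lra.
    rewrite -!Rpower_pow // YT Rpower_mult; apply: Rpower_lt; first lra.
    rewrite (_ : INR 3 = 3); last by rewrite INR_IZR_INZ.
    lra.
have /ssrnat.ltP/lt_INR := leq_trans core (leq_count_cubic_prime_residues p XltY).
lra.
Qed.
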